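(* Let $M$ be a simple partition matroid on ground set $N=N_1\cup\dots\cup N_\rho$ (disjoint parts; a set is independent iff it has at most one element from each part), and let $p\in[0,1]$. Consider the following algorithm: draw $m$ from the binomial distribution $B(|N|,p)$, request a uniformly random sample $S$ of $m$ elements, set $I=\varnothing$; for each arriving non-sample element $e$, letting $N(e)$ be its part and $t_e$ the maximum-weight element of $S\cap N(e)$, add $e$ to $I$ if $I\cap N(e)=\varnothing$ and ($S\cap N(e)=\varnothing$ or $w(e)>w(t_e)$); output $I$. This algorithm is an order-oblivious $p(1-p)$-OPT-competitive algorithm for the Matroid Secretary Problem on simple partition matroids. In particular, for $p=1/2$ it is $1/4$-OPT-competitive.
   Context: Order-oblivious secretary model: the algorithm receives a uniformly random sample of a chosen size (sampled elements cannot be selected); the other elements then arrive in an adversarial order that may depend on the sample but not on the algorithm's random bits, and each must be irrevocably accepted or rejected on arrival; the output must be independent. Weights are nonnegative with ties broken consistently, so the maximum-weight independent set $\mathrm{OPT}$ is unique and contains no weight-$0$ element. An order-oblivious algorithm $\mathcal{A}$ is $c$-OPT-competitive if for every weight function and every $e\in\mathrm{OPT}$, $\mathbb{E}_S[\min_\sigma\Pr_r[e\in\mathcal{A}(S,r,\sigma)]]\ge c$, where $\mathcal{A}(S,r,\sigma)$ is the output given sample $S$, random bits $r$ and arrival order $\sigma$ (which may depend on $S$ and $e$). *)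

(* Defs.v *)
From HB Require Import structures.
From mathcomp Require Import all_boot all_order all_algebra.
Set Implicit Arguments.
Unset Strict Implicit.
Unset Printing Implicit Defensive.
Import Order.TTheory GRing.Theory Num.Theory.
Local Open Scope ring_scope.

Record matroid (T : finType) := Matroid {
  indep : pred {set T};
  indep_set0 : indep set0;
  indep_subset : forall X Y : {set T}, X \subset Y -> indep Y -> indep X;
  indep_exchange : forall X Y : {set T}, indep X -> indep Y ->
    (#|X| < #|Y|)%N -> exists2 y, y \in Y :\: X & indep (y |: X)
}.

Definition simple_partition_matroid (T : finType) (M : matroid T)
    (P : {set {set T}}) : Prop :=
  partition P [set: T] /\
  forall X : {set T}, indep M X = [forall B in P, (#|X :&: B| <= 1)%N].

(* Ties are broken by a fixed linear order [tb] on the ground set, known to    *)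
(* the algorithm; [tb x y] reads "x is preferred to (or is) y".               *)
Definition tie_breaking (T : finType) (tb : rel T) : Prop :=
  [/\ total tb, antisymmetric tb & transitive tb].

(* "w(x) > w(y)" once ties are broken. *)
Definition heavier (R : realFieldType) (T : finType) (tb : rel T)
    (w : T -> R) (x y : T) : bool :=
  (w y < w x) || [&& w y == w x, x != y & tb x y].

Definition max_weight_indep (R : realFieldType) (T : finType) (M : matroid T)
    (w : T -> R) (X : {set T}) : Prop :=
  indep M X /\
  forall Y : {set T}, indep M Y -> \sum_(y in Y) w y <= \sum_(x in X) w x.

Definition opt_candidate (R : realFieldType) (T : finType) (M : matroid T)
    (w : T -> R) (X : {set T}) : Prop :=
  max_weight_indep M w X /\ forall x, x \in X -> w x != 0.

(* Among the candidates, OPT is the one favoured by [tb], in the              *)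
(* lexicographic sense: the [tb]-first element on which OPT and any other     *)
(* candidate differ belongs to OPT. This is the maximum-weight independent    *)
(* set for weights perturbed by infinitesimals decreasing along [tb].         *)
Definition is_OPT (R : realFieldType) (T : finType) (M : matroid T)
    (tb : rel T) (w : T -> R) (X : {set T}) : Prop :=
  opt_candidate M w X /\
  forall Y : {set T}, opt_candidate M w Y -> Y != X ->
    exists2 x, x \in X :\: Y & forall y, y \in Y :\: X -> tb x y.

Lemma OPT_exists_unique (R : realFieldType) (T : finType) (M : matroid T)
    (tb : rel T) (w : T -> R) :
  tie_breaking tb -> (forall x, 0 <= w x) -> exists! X, is_OPT M tb w X.
Proof.
move=> [tbT tbA tbt] w0.
pose cand := [pred X : {set T} | [&& indep M X,
  [forall Y : {set T}, indep M Y ==> (\sum_(y in Y) w y <= \sum_(x in X) w x)]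
  & [forall x in X, w x != 0]]].
have candP X : reflect (opt_candidate M w X) (cand X).
  apply: (iffP and3P) => [[iX /forallP mX /forall_inP zX]|[[iX mX] zX]].
    by split=> //; split=> // Y iY; apply: (implyP (mX Y)).
  split=> //; first by apply/forallP=> Y; apply/implyP/mX.
  by apply/forall_inP.
pose pre (X Y : {set T}) :=
  [exists x in X :\: Y, [forall y in Y :\: X, tb x y]].
have preP X Y : reflect (exists2 x, x \in X :\: Y &
    forall y, y \in Y :\: X -> tb x y) (pre X Y).
  by apply: (iffP exists_inP) => -[x xXY /forall_inP h]; exists x.
have pre_trans X Y Z : pre X Y -> pre Y Z -> pre X Z.
  move=> /preP[x /setDP[xX xY] hx] /preP[y /setDP[yY yZ] hy].
  have agree u : u \in Z -> u \notin X -> tb u x -> tb u y -> False.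
    move=> uZ uX ux uy; have [uY|uY] := boolP (u \in Y).
      have /hx xu : u \in Y :\: X by rewrite inE uX.
      by move: uX; rewrite (tbA u x) ?xX // ux.
    have /hy yu : u \in Z :\: Y by rewrite inE uY.
    by move: uY; rewrite (tbA u y) ?yY // uy.
  have nxy : x != y by apply: contraNneq xY => ->.
  have [xy|yx] := orP (tbT x y); apply/preP.
    have xZ : x \notin Z.
      apply/negP=> xZ; have /hy yx : x \in Z :\: Y by rewrite inE xY.
      by move/eqP: nxy; apply; apply: tbA; rewrite xy.
    exists x; first by rewrite inE xZ.
    move=> u /setDP[uZ uX]; have [//|ux] := orP (tbT x u).
    by case: (agree u uZ uX ux); apply: tbt xy.
  have yX : y \in X.
    apply/negPn/negP=> yX; have /hx xy : y \in Y :\: X by rewrite inE yX.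
    by move/eqP: nxy; apply; apply: tbA; rewrite xy.
  exists y; first by rewrite inE yZ.
  move=> u /setDP[uZ uX]; have [//|uy] := orP (tbT y u).
  by case: (agree u uZ uX _ uy); apply: tbt yx.
have first_el (A : {set T}) : A != set0 ->
    exists2 z, z \in A & forall y, y \in A -> tb z y.
  case/set0Pn=> a aA.
  case: (@arg_maxnP _ a (mem A) (fun z => #|[set y in A | tb z y]|) aA) => z zA mz.
  exists z => // y yA; have [//|yz] := orP (tbT z y).
  suff /eqP <- : y == z by have := tbT y y; rewrite orbb.
  apply/negPn/negP=> nyz; have := mz _ yA; rewrite /= leqNgt => /negP; apply.
  apply: proper_card; apply/properP; split.
    by apply/subsetP=> u; rewrite !inE => /andP[-> zu]; apply: tbt zu.
  exists y; first by rewrite !inE yA; have := tbT y y; rewrite orbb.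
  rewrite !inE yA /=; apply: contra nyz => zy.
  by apply/eqP/tbA; rewrite yz.
have pre_total X Y : X != Y -> pre X Y || pre Y X.
  move=> nXY; have /first_el[z] : (X :\: Y) :|: (Y :\: X) != set0.
    by rewrite setU_eq0 !setD_eq0 -eqEsubset.
  rewrite inE => /orP[] zD hz; apply/orP; [left|right]; apply/preP;
    by exists z => // y yD; apply: hz; rewrite inE yD ?orbT.
have pre_irr X : pre X X = false.
  by apply/negbTE/negP=> /preP[x xXX _]; rewrite setDv inE in xXX.
have [X0 cX0] : exists X, cand X.
  case: (@arg_maxP _ R _ set0 (indep M) (fun X : {set T} => \sum_(x in X) w x)
    (indep_set0 M)) => X iX mX.
  exists [set x in X | w x != 0]; apply/candP; split; last first.
    by move=> x; rewrite inE => /andP[].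
  split; first by apply: indep_subset iX; apply/subsetP=> x; rewrite inE; case/andP.
  move=> Y iY; apply: le_trans (mX _ iY) _.
  rewrite (bigID (fun x => w x != 0)) /= [X in _ + X]big1 ?addr0; last first.
    by move=> x /andP[_ /negPn/eqP].
  by rewrite le_eqVlt; apply/orP; left; apply/eqP/eq_bigl => x; rewrite inE.
case: (@arg_maxnP _ X0 cand (fun X => #|[set Y | cand Y & pre X Y]|) cX0)
  => X cX mX.
exists X; split; last first.
  move=> Y [/candP cY hY]; apply/eqP/negPn/negP => nXY.
    idtac.
  have pYX : pre Y X.
    by apply/preP; apply: hY => //; apply/candP.
  have := mX _ cY; rewrite /= leqNgt => /negP; apply.
  apply: proper_card; apply/properP; split.
    by apply/subsetP=> Z; rewrite !in_set => /andP[-> /(pre_trans _ _ _ pYX)].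
  by exists X; rewrite in_set ?pre_irr ?andbF //; apply/andP.
split; first exact/candP.
move=> Y /candP cY nYX; apply/preP.
have [pYX|//] := orP (pre_total _ _ nYX).
have := mX _ cY; rewrite /= leqNgt => /negP; case.
apply: proper_card; apply/properP; split.
  by apply/subsetP=> Z; rewrite !in_set => /andP[-> /(pre_trans _ _ _ pYX)].
by exists X; rewrite in_set ?pre_irr ?andbF //; apply/andP.
Qed.

(* An algorithm in the order-oblivious model. It draws the sample size from   *)
(* [size_law] and, independently of the sample, its remaining random bits     *)
(* from [bits_law]. [accept r S v past I e] is the decision on the arrival of *)
(* [e] when the bits are [r], the sample is [S], the observed weights are [v],*)
(* the elements that arrived before [e] are [past] (in this order), and [I]   *)
(* is the set of those that were accepted.                                    *)
Record oo_algorithm (R : realFieldType) (T : finType) := OOAlgorithm {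
  size_law : 'I_#|T|.+1 -> R;
  bits : finType;
  bits_law : bits -> R;
  accept : bits -> {set T} -> (T -> option R) -> seq T -> {set T} -> T -> bool
}.

Definition is_distribution (R : realFieldType) (D : finType) (f : D -> R) : Prop :=
  (forall x, 0 <= f x) /\ \sum_x f x = 1.

(* Only the weights of the elements in [seen] are revealed. *)
Definition observed (R : realFieldType) (T : finType) (w : T -> R)
    (seen : {set T}) : T -> option R :=
  fun x => if x \in seen then Some (w x) else None.

Fixpoint run (R : realFieldType) (T : finType) (A : oo_algorithm R T)
    (w : T -> R) (S : {set T}) (r : bits A) (past : seq T) (I : {set T})
    (future : seq T) : {set T} :=
  if future is e :: future' then
    let past' := rcons past e in
    let v := observed w (S :|: [set x in past']) in
    run w S r past' (if accept r S v past I e then e |: I else I) future'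
  else I.

Definition output (R : realFieldType) (T : finType) (A : oo_algorithm R T)
    (w : T -> R) (S : {set T}) (r : bits A) (sigma : seq T) : {set T} :=
  run w S r [::] set0 sigma.

Definition arrival_orders (T : finType) (S : {set T}) : seq (seq T) :=
  permutations (enum (~: S)).

Definition expect_sample (R : realFieldType) (T : finType)
    (A : oo_algorithm R T) (F : {set T} -> R) : R :=
  \sum_(m < #|T|.+1) size_law A m *
    ((\sum_(S : {set T} | #|S| == m) F S) / 'C(#|T|, m)%:R).

Definition prob_bits (R : realFieldType) (T : finType) (A : oo_algorithm R T)
    (E : pred (bits A)) : R := \sum_(r | E r) bits_law r.

(* The list of orders is nonempty and probabilities are at most 1, so the     *)
(* initial value 1 does not affect the minimum.                               *)
Definition min_order (R : realFieldType) (T : finType) (S : {set T})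
    (F : seq T -> R) : R :=
  \big[Num.min/1]_(sigma <- arrival_orders S) F sigma.

Definition order_oblivious (R : realFieldType) (T : finType) (M : matroid T)
    (A : oo_algorithm R T) : Prop :=
  [/\ is_distribution (size_law A),
      is_distribution (@bits_law R T A) &
      forall (w : T -> R) (S : {set T}) (r : bits A) (sigma : seq T),
        (forall x, 0 <= w x) -> sigma \in arrival_orders S ->
        indep M (output w S r sigma)].

(* The arrival order is chosen after [S] (and [e]) but before [r]. *)
Definition OPT_competitive (R : realFieldType) (T : finType) (M : matroid T)
    (tb : rel T) (c : R) (A : oo_algorithm R T) : Prop :=
  forall w : T -> R, (forall x, 0 <= w x) ->
  forall O : {set T}, is_OPT M tb w O ->
  forall e, e \in O ->
    c <= expect_sample A (fun S =>
           min_order S (fun sigma =>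
             @prob_bits R T A (fun r => e \in output w S r sigma))).

Definition binomial_law (R : realFieldType) (n : nat) (p : R) (m : 'I_n.+1) : R :=
  p ^+ m * (1 - p) ^+ (n - m) *+ 'C(n, m).

Definition heaviest (R : realFieldType) (T : finType) (tb : rel T)
    (w : T -> R) (A : {set T}) : option T :=
  [pick t in A | [forall x in A, (x != t) ==> heavier tb w t x]].

Definition partition_rule (R : realFieldType) (T : finType) (P : {set {set T}})
    (tb : rel T) (S : {set T}) (v : T -> option R) (I : {set T}) (e : T) : bool :=
  let w x := odflt 0 (v x) in
  let N := pblock P e in
  (I :&: N == set0) &&
  ((S :&: N == set0) ||
   (if heaviest tb w (S :&: N) is Some t then heavier tb w e t else false)).

(* The rule uses no random bits, and the past only through the set [I]. *)
Definition partition_algorithm (R : realFieldType) (T : finType)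
    (P : {set {set T}}) (tb : rel T) (p : R) : oo_algorithm R T :=
  @OOAlgorithm R T (@binomial_law R #|T| p) unit (fun=> 1)
    (fun _ S v _ I e => partition_rule P tb S v I e).

(* Main.v *)
(** An element [e] of OPT is the heaviest element of its part [N]: exchanging it
    for a heavier one would contradict the choice of OPT. Let [f] be the heaviest
    element of [N] other than [e], if there is one. Whenever [f] is sampled and
    [e] is not, [f] is the threshold of the part and [e] is the only element
    above it, so [e] is accepted whatever the arrival order. A uniform sample of
    binomial size contains each element independently with probability [p], so
    this happens with probability [p (1 - p)]. If [N = {e}], it suffices that [e]
    is not sampled, which has probability [1 - p]. *)
Require Import Defs.
From HB Require Import structures.
From mathcomp Require Import all_boot all_order all_algebra.
From mathcomp Require Import lra.
Set Implicit Arguments.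
Unset Strict Implicit.
Unset Printing Implicit Defensive.
Import Order.TTheory GRing.Theory Num.Theory.
Local Open Scope ring_scope.

(** * Comparing weights with ties broken *)

Lemma tie_breaking_refl (T : finType) (tb : rel T) :
  tie_breaking tb -> reflexive tb.
Proof. by case=> tbT _ _ x; have := tbT x x; rewrite orbb. Qed.

Lemma heavierN (R : realFieldType) (T : finType) (tb : rel T) (w : T -> R)
    (x y : T) :
  tie_breaking tb -> x != y -> heavier tb w x y = ~~ heavier tb w y x.
Proof.
case=> tbT tbA _ nxy; rewrite /heavier nxy (eq_sym y x) nxy /= (eq_sym (w x)).
have [_|_|_] //= := ltgtP (w x) (w y).
have := tbT x y; have := tbA x y.
case: (tb x y) (tb y x) => [] [] //= /(_ isT) exy.
by rewrite exy eqxx in nxy.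
Qed.

Lemma heaviest_exists (R : realFieldType) (T : finType) (tb : rel T)
    (w : T -> R) (A : {set T}) :
  tie_breaking tb -> A != set0 ->
  exists2 t, t \in A & forall x, x \in A -> x != t -> heavier tb w t x.
Proof.
move=> htb /set0Pn[a aA]; have [tbT tbA tbt] := htb.
(* [ge] is the reflexive form of [heavier]: a total preorder, as [extremumP] requires. *)
pose ge x y := (w y < w x) || (w y == w x) && tb x y.
have ge_refl : reflexive ge by move=> x; rewrite /ge eqxx tie_breaking_refl ?orbT.
have ge_total : total ge.
  by move=> x y; rewrite /ge; case: ltgtP => //= _; apply: tbT.
have ge_trans : transitive ge.
  move=> y x z /orP[lyx|/andP[/eqP eyx xy]] /orP[lzy|/andP[/eqP ezy yz]].
  - by rewrite /ge (lt_trans lzy lyx).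
  - by rewrite /ge ezy lyx.
  - by rewrite /ge -eyx lzy.
  - by rewrite /ge ezy eyx eqxx (tbt _ _ _ xy yz) orbT.
case: (@extremumP T T ge a (mem A) id ge_refl ge_trans ge_total aA) => t tA ht.
exists t => // x xA nxt; have := ht x xA.
by rewrite /ge /heavier (eq_sym t) nxt.
Qed.

Lemma heaviest_eq (R : realFieldType) (T : finType) (tb : rel T) (w : T -> R)
    (A : {set T}) (t : T) :
  tie_breaking tb -> t \in A ->
  (forall x, x \in A -> x != t -> heavier tb w t x) -> heaviest tb w A = Some t.
Proof.
move=> htb tA ht; rewrite /heaviest; case: pickP => [u /andP[uA]|/(_ t)].
  move=> /forall_inP/(_ _ tA)/implyP hu; congr Some; apply/eqP/negPn/negP => nut.
  have := hu; rewrite eq_sym => /(_ nut).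
  by rewrite heavierN // ht.
rewrite tA /= => /negbT/forall_inPn[x xA]; rewrite negb_imply => /andP[nxt].
by rewrite ht.
Qed.

(** Serves twice: for the exchange in OPT and for each acceptance by the algorithm. The block of [e]
    then contains [e] alone, and no other block sees [e]. *)
Lemma pblock_setU1_card_le1 (T : finType) (P : {set {set T}}) (X : {set T}) (e : T) :
  partition P [set: T] ->
  [forall B in P, (#|X :&: B| <= 1)%N] -> X :&: pblock P e = set0 ->
  [forall B in P, (#|(e |: X) :&: B| <= 1)%N].
Proof.
move=> /and3P[/eqP covP trP _] /forall_inP hX Xe0; apply/forall_inP => B BP.
rewrite setIUl; have [eB|eB] := boolP (e \in B).
  have <- := def_pblock trP BP eB.
  by rewrite Xe0 setU0 (leq_trans (subset_leq_card (subsetIl _ _))) ?cards1.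
suff -> : [set e] :&: B = set0 by rewrite set0U hX.
by apply/setP=> x; rewrite !inE; case: eqP => // ->; apply/negbTE.
Qed.

(** Since [O] meets the block only in [e], replacing [e] by [x] keeps independence. If [x] had
    larger weight, the new set would beat [O]; if [x] won a tie, the new set would be a candidate
    that [tb] favours over [O]. *)
Lemma OPT_heaviest_in_block (R : realFieldType) (T : finType) (M : matroid T)
    (P : {set {set T}}) (tb : rel T) (w : T -> R) (O : {set T}) (e x : T) :
  simple_partition_matroid M P -> tie_breaking tb -> is_OPT M tb w O ->
  e \in O -> x \in pblock P e -> x != e -> heavier tb w e x.
Proof.
move=> [partP indepE] htb [[[iO maxO] nzO] firstO] eO xe nxe.
have [/eqP covP trP _] := and3P partP.
have covT y : y \in cover P by rewrite covP inE.
have uniq_block y : y \in O -> y \in pblock P e -> y = e.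
  move=> yO ye; move: iO; rewrite indepE => /forall_inP/(_ _ (pblock_mem (covT e))).
  by move/card_le1_eqP; apply; rewrite inE ?yO ?eO ?ye // mem_pblock covT.
have xO : x \notin O by apply: contraNN nxe => xO; rewrite (uniq_block x).
rewrite heavierN 1?eq_sym //; apply/negP => hxe.
pose Y := x |: O :\ e.
have sumY : \sum_(y in Y) w y = w x + \sum_(y in O :\ e) w y.
  by rewrite big_setU1 // in_setD1 (negbTE xO) andbF.
have sumO : \sum_(y in O) w y = w e + \sum_(y in O :\ e) w y.
  by rewrite (big_setD1 e).
have iY : indep M Y.
  rewrite indepE; apply: pblock_setU1_card_le1 => //.
    by rewrite -indepE; apply: indep_subset iO; apply: subsetDl.
  rewrite (same_pblock trP xe); apply/setP => y; rewrite !inE.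
  apply/negbTE/negP => /andP[/andP[nye yO] ye].
  by rewrite (uniq_block y) ?eqxx in nye.
have := maxO _ iY; rewrite sumY sumO lerD2r => lexe.
case/orP: hxe => [|/and3P[/eqP eq_ex _ tbxe]]; first by rewrite ltNge lexe.
have cY : opt_candidate M w Y.
  split; first by split=> // Z /maxO; rewrite sumY sumO eq_ex.
  by move=> y /setU1P[->|/setD1P[_ /nzO]//]; rewrite -eq_ex nzO.
have nYO : Y != O by apply: contraNneq xO => <-; rewrite setU11.
have [z /setDP[zO zY] hz] := firstO _ cY nYO.
(* [e] is the only element of [O] outside [Y], so preferring [O] to [Y] means [tb e x], against
   [tb x e]. *)
have ez : z = e.
  by apply/eqP; move: zY; rewrite !inE zO andbT negb_or negbK => /andP[].
have tbex : tb e x by rewrite -ez; apply: hz; rewrite inE setU11 xO.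
by case: htb => _ /(_ e x) tbA _; rewrite tbA ?tbex ?eqxx in nxe.
Qed.

(** * Runs of an algorithm over the arriving elements *)

(** Invariant of the run: either [e] is already accepted, or nothing in [N] is and [e] is still to
    come. Arrivals outside [N] leave [I :&: N] unchanged, and inside [N] only [e] can be
    accepted. *)
Lemma mem_run (R : realFieldType) (T : finType) (A : oo_algorithm R T)
    (w : T -> R) (S N : {set T}) (r : bits A) (e : T) (future : seq T) :
  e \in N ->
  (forall past (I : {set T}) x, x \notin S -> x \in N -> I :&: N = set0 ->
    accept r S (observed w (S :|: [set y in rcons past x])) past I x = (x == e)) ->
  {in future, forall x, x \notin S} ->
  forall past (I : {set T}),
    (e \in I) || (I :&: N == set0) && (e \in future) ->
    e \in run w S r past I future.
Proof.
move=> eN only_e; elim: future => [|x future IH] outS past I /=.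
  by rewrite andbF orbF.
have /IH{}IH : {in future, forall y, y \notin S}.
  by move=> y yf; apply: outS; rewrite inE yf orbT.
move=> h; apply: IH; set b := accept _ _ _ _ _ _.
move: h; have [eI _|/= eI] := boolP (e \in I).
  by apply/orP; left; case: b => //; rewrite inE eI orbT.
rewrite in_cons => /andP[/eqP IN0 ef].
have xS : x \notin S by apply: outS; rewrite mem_head.
have [xN|xN] := boolP (x \in N).
  rewrite /b only_e // (eq_sym e) in ef *; have [->|nxe] := eqVneq x e.
    by rewrite setU11.
  by move: ef; rewrite (negbTE nxe) IN0 eqxx /= => ->; rewrite orbT.
have nex : e != x by apply: contraNneq xN => <-.
rewrite (negbTE nex) /= in ef; rewrite ef andbT.
case: b; last by rewrite IN0 eqxx orbT.
rewrite setIUl IN0 setU0; apply/orP; right; apply/eqP/setP => y; rewrite !inE.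
by case: eqP => // ->; apply/negbTE.
Qed.

Lemma run_partition_indep (R : realFieldType) (T : finType) (P : {set {set T}})
    (tb : rel T) (p : R) (w : T -> R) (S : {set T}) (r : unit) (future : seq T) :
  partition P [set: T] ->
  forall past (I : {set T}), [forall B in P, (#|I :&: B| <= 1)%N] ->
  [forall B in P,
    (#|run (A := partition_algorithm P tb p) w S r past I future :&: B| <= 1)%N].
Proof.
move=> partP; elim: future => [|x future IH] past I //= hI; apply: IH.
by case: ifP => // /andP[/eqP Ix0 _]; apply: pblock_setU1_card_le1.
Qed.

(** * Binomial sampling as independent inclusion *)

(** Expand a product with one factor per element: [p + 0] on [A], [0 + (1 - p)] on [B], and
    [p + (1 - p) = 1] elsewhere. The first summand stands for membership in [S], the second for
    absence. *)
Lemma sum_binomial_weights (R : comPzRingType) (T : finType) (p : R)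
    (A B : {set T}) : [disjoint A & B] ->
  \sum_(S : {set T} | (A \subset S) && [disjoint B & S])
     p ^+ #|S| * (1 - p) ^+ (#|T| - #|S|) = p ^+ #|A| * (1 - p) ^+ #|B|.
Proof.
move=> dAB.
pose F i : R := if i \in B then 0 else p.
pose G i : R := if i \in A then 0 else 1 - p.
have -> : p ^+ #|A| * (1 - p) ^+ #|B| = \prod_i (F i + G i).
  rewrite -!prodr_const big_mkcond [X in _ * X]big_mkcond -big_split.
  apply: eq_bigr => i _; rewrite /F /G /=.
  have [iA|_] := boolP (i \in A).
    by rewrite (disjointFr dAB iA) mulr1 addr0.
  by case: ifP => _; rewrite mul1r ?add0r // addrC subrK.
rewrite bigA_distr [LHS]big_mkcond; apply: eq_bigr => S _.
case: ifP => [/andP[/subsetP AS dBS]|].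
  rewrite (bigID (mem S)) /= (eq_bigr (fun=> p)); last first.
    by move=> i iS; rewrite iS /F (disjointFl dBS iS).
  rewrite [X in _ = _ * X](eq_bigr (fun=> 1 - p)); last first.
    move=> i iS; rewrite (negbTE iS) /G ifN //.
    by apply: contra iS => /AS.
  by rewrite !prodr_const -[#|T|](cardC (mem S)) addKn.
(* If [S] misses some [i] of [A] or contains some [i] of [B], the factor at [i] is zero. *)
move=> /negbT; rewrite negb_and => /orP[/subsetPn[i iA iS]|].
  by rewrite (bigD1 i) //= (negbTE iS) /G iA mul0r.
rewrite -setI_eq0 => /set0Pn[i /setIP[iB iS]].
by rewrite (bigD1 i) //= iS /F iB mul0r.
Qed.

Lemma binomial_law_distribution (R : realFieldType) (n : nat) (p : R) :
  0 <= p <= 1 -> is_distribution (@binomial_law R n p).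
Proof.
move=> /andP[p0 p1]; split=> [m|].
  by rewrite mulrn_wge0 // mulr_ge0 // exprn_ge0 // subr_ge0.
(* Binomial theorem for [(1 - p + p) ^+ n]. *)
rewrite -[RHS](expr1n _ n) -[in RHS](subrK p 1) exprDn.
by apply: eq_bigr => m _; rewrite /binomial_law mulrC.
Qed.

(** Group the subsets by size: the binomial coefficient in the size law cancels the number of
    equally likely samples of that size. *)
Lemma expect_binomial_sample (R : realFieldType) (T : finType)
    (P : {set {set T}}) (tb : rel T) (p : R) (F : {set T} -> R) :
  expect_sample (partition_algorithm P tb p) F =
  \sum_(S : {set T}) p ^+ #|S| * (1 - p) ^+ (#|T| - #|S|) * F S.
Proof.
rewrite (partition_big (fun S : {set T} => inord #|S| : 'I_#|T|.+1) predT) //=.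
apply: eq_bigr => m _ /=.
have cardE (S : {set T}) : (inord #|S| == m :> 'I_#|T|.+1) = (#|S| == m).
  by rewrite -val_eqE /= inordK // ltnS max_card.
rewrite (eq_bigl _ _ cardE).
rewrite [RHS](eq_bigr (fun S => p ^+ m * (1 - p) ^+ (#|T| - m) * F S)).
  rewrite -mulr_sumr /binomial_law -mulr_natr -!mulrA.
  by rewrite ['C(_, _)%:R * _]mulrC divfK // pnatr_eq0 -lt0n bin_gt0 -ltnS.
by move=> S /eqP ->.
Qed.

(** The bound [c <= 1] handles the initial value of the iterated minimum. *)
Lemma le_min_order (R : realFieldType) (T : finType) (S : {set T})
    (F : seq T -> R) (c : R) :
  c <= 1 -> {in arrival_orders S, forall sigma, c <= F sigma} ->
  c <= min_order S F.
Proof.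
move=> c1 hF; rewrite /min_order big_seq.
by elim/big_ind: _ => // x y cx cy; rewrite le_min cx.
Qed.

(** * The acceptance rule and its guarantees *)

Lemma partition_rule_threshold (R : realFieldType) (T : finType)
    (P : {set {set T}}) (tb : rel T) (w : T -> R) (S I : {set T}) (e f x : T)
    (past : seq T) :
  tie_breaking tb -> trivIset P ->
  (forall y, y \in pblock P e -> y != e -> heavier tb w e y) ->
  f \in S :&: pblock P e -> f != e -> e \notin S ->
  (forall y, y \in pblock P e -> y != e -> y != f -> heavier tb w f y) ->
  x \in pblock P e -> x \notin S -> I :&: pblock P e = set0 ->
  partition_rule P tb S (observed w (S :|: [set y in rcons past x])) I x = (x == e).
Proof.
move=> htb trP he fSN nfe eS hf xN xS IN0.
have [fS fN] := setIP fSN.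
rewrite /partition_rule (same_pblock trP xN) IN0 eqxx /=.
have /negbTE -> : S :&: pblock P e != set0 by apply/set0Pn; exists f.
(* [v] reads unseen weights as 0, but the rule compares only sampled elements and [x] itself, where
   [v] agrees with [w]. *)
set v := fun _ => _.
have vS y : y \in S -> v y = w y by move=> yS; rewrite /v /observed inE yS.
have vx : v x = w x by rewrite /v /observed !inE mem_rcons mem_head orbT.
rewrite (@heaviest_eq _ _ _ _ _ f) //=.
  rewrite {1}/heavier vx vS // -/(heavier tb w x f).
  have [->|nxe] := eqVneq x e; first by rewrite he.
  have nxf : x != f by apply: contraNneq xS => ->.
  by rewrite heavierN // hf.
move=> y /setIP[yS yN] nyf; rewrite /heavier !vS // -/(heavier tb w f y) hf //.
by apply: contraNneq eS => <-.
Qed.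

Lemma partition_algorithm_order_oblivious (R : realFieldType) (T : finType)
    (M : matroid T) (P : {set {set T}}) (tb : rel T) (p : R) :
  simple_partition_matroid M P -> 0 <= p <= 1 ->
  order_oblivious M (partition_algorithm P tb p).
Proof.
move=> [partP indepE] hp; split; first exact: binomial_law_distribution.
  split=> [r|]; first exact: ler01.
  by rewrite big_const card_unit /= addr0.
move=> w S r sigma _ _; rewrite indepE; apply: run_partition_indep => //.
by apply/forall_inP => B _; rewrite set0I cards0.
Qed.

Lemma partition_algorithm_OPT_competitive (R : realFieldType) (T : finType)
    (M : matroid T) (P : {set {set T}}) (tb : rel T) (p : R) :
  simple_partition_matroid M P -> tie_breaking tb -> 0 <= p <= 1 ->
  OPT_competitive M tb (p * (1 - p)) (partition_algorithm P tb p).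
Proof.
move=> hM htb hp w w0 O optO e eO.
have [/and3P[/eqP covP trP _] _] := hM; have /andP[p0 p1] := hp.
have q0 : 0 <= 1 - p by rewrite subr_ge0.
have eN : e \in pblock P e by rewrite mem_pblock covP inE.
have he y := OPT_heaviest_in_block (x := y) hM htb optO eO.
(* [A] collects what must be sampled for [e] to be safe: the runner-up of its block, or nothing if
   the block is a singleton. This treats both cases at once. *)
suff [A [dAe cA only_e]] : exists A : {set T}, [/\ [disjoint A & [set e]],
    (#|A| <= 1)%N & forall S : {set T}, A \subset S -> e \notin S ->
    forall past (I : {set T}) x, x \notin S -> x \in pblock P e ->
      I :&: pblock P e = set0 ->
      partition_rule P tb S (observed w (S :|: [set y in rcons past x])) I x
        = (x == e)].
  have pA : p * (1 - p) <= p ^+ #|A| * (1 - p) ^+ #|[set e]|.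
    rewrite cards1 expr1 ler_wpM2r //.
    by case: #|A| cA => [|[]].
  apply: le_trans pA _; rewrite -sum_binomial_weights // expect_binomial_sample.
  rewrite big_mkcond; apply: ler_sum => S _.
  set F := min_order S _.
  have mu0 : 0 <= p ^+ #|S| * (1 - p) ^+ (#|T| - #|S|).
    by rewrite mulr_ge0 // exprn_ge0.
  (* Samples outside the event contribute at least 0; on the event, [e] is output with probability 1
     under every order. *)
  case: ifP => [/andP[AS]|_]; last first.
    rewrite mulr_ge0 //; apply: le_min_order => // sigma _.
    by apply: sumr_ge0 => r _; apply: ler01.
  rewrite disjoints1 => eS; apply: ler_peMr => //.
  apply: le_min_order => // sigma; rewrite mem_permutations => /perm_mem memS.
  rewrite /prob_bits (bigD1 tt) /=; last first.
    apply: (mem_run eN); first exact: only_e.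
      by move=> x; rewrite memS mem_enum inE.
    by rewrite set0I eqxx memS mem_enum !inE eS.
  by rewrite lerDl; apply: sumr_ge0 => r _; apply: ler01.
have [Ne|Ne] := eqVneq (pblock P e :\ e) set0.
  exists set0; split; rewrite ?cards0 //; first by rewrite -setI_eq0 set0I.
  have only y : y \in pblock P e -> y = e.
    move=> yN; apply/eqP/negPn/negP => nye.
    by have := in_set0 y; rewrite -Ne !inE nye yN.
  move=> S _ eS past I x xS /only -> IN0; rewrite eqxx /partition_rule IN0 eqxx /=.
  suff -> : S :&: pblock P e = set0 by rewrite eqxx.
  apply/setP => y; rewrite !inE; apply/negbTE.
  by apply: contraNN eS => /andP[yS /only <-].
have [f /setD1P[nfe fN] hf] := heaviest_exists w htb Ne.
exists [set f]; split; rewrite ?cards1 ?disjoints1 ?inE //.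
move=> S; rewrite sub1set => fS eS past I x xS xN IN0.
apply: (@partition_rule_threshold _ _ _ _ _ _ _ _ f) => //; first by rewrite inE fS.
by move=> y yN nye; apply: hf; rewrite !inE nye.
Qed.

Theorem theorem19 (R : realFieldType) (T : finType) (M : matroid T)
    (P : {set {set T}}) (tb : rel T) (p : R)
    (hM : simple_partition_matroid M P) (htb : tie_breaking tb)
    (hp : 0 <= p <= 1) :
  (order_oblivious M (partition_algorithm P tb p) /\
   OPT_competitive M tb (p * (1 - p)) (partition_algorithm P tb p)) /\
  (order_oblivious M (partition_algorithm P tb (1 / 2 : R)) /\
   OPT_competitive M tb (1 / 4) (partition_algorithm P tb (1 / 2 : R))).
Proof.
have half01 : 0 <= (1 / 2 : R) <= 1 by lra.
have -> : 1 / 4 = 1 / 2 * (1 - 1 / 2) :> R by lra.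
by split; split; [exact: partition_algorithm_order_oblivious
  | exact: partition_algorithm_OPT_competitive
  | exact: partition_algorithm_order_oblivious
  | exact: partition_algorithm_OPT_competitive].
Qed.
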